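(* Let $\mathbb{F}$ be a field, let $n\ge 3$ and $k\ge 1$ be integers, and consider the partial block matrix over $\mathbb{F}$ $$\mathcal{A}=\begin{bmatrix} A_{11} & A_{12} & ? & \cdots & ?\\ ? & A_{22} & A_{23} & \ddots & \vdots\\ \vdots & \ddots & \ddots & \ddots & ?\\ ? & \cdots & ? & A_{n-1,n-1} & A_{n-1,n}\\ A_{n1} & ? & \cdots & ? & A_{nn} \end{bmatrix},$$ whose specified blocks are exactly $A_{ii}$ ($1\le i\le n$), $A_{i,i+1}$ ($1\le i\le n-1$) and $A_{n1}$, each specified block being an invertible $k\times k$ matrix over $\mathbb{F}$. Put $$H=A_{11}^{-1}A_{12}A_{22}^{-1}A_{23}A_{33}^{-1}\cdots A_{n-1,n-1}^{-1}A_{n-1,n}A_{nn}^{-1}A_{n1}$$ and $d=\dim\ker(H-I)$. Then $$\operatorname{mr}(\mathcal{A})\ge\frac{nk-d}{n-1}.$$ Moreover, when $d=k$ equality holds, i.e. $\operatorname{mr}(\mathcal{A})=k$. Finally, when $k=n-1$, $d=0$, and $H$ has all $k$ of its eigenvalues (counted with algebraic multiplicity) in $\mathbb{F}$, equality holds: $\operatorname{mr}(\mathcal{A})=n$. (In particular, if $\mathbb{F}$ is algebraically closed, the condition on the eigenvalues of $H$ is automatically satisfied.)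
   Context: A partial block matrix over $\mathbb{F}$ is a block array in which some blocks are specified matrices over $\mathbb{F}$ and the others (denoted $?$) are unspecified. Here all blocks are $k\times k$. A completion is a matrix over $\mathbb{F}$ obtained by replacing each unspecified block by an arbitrary $k\times k$ matrix over $\mathbb{F}$. The minimal rank $\operatorname{mr}(\mathcal{A})$ is the minimum of $\operatorname{rank} B$ over all completions $B$ of $\mathcal{A}$. *)

(* Defs.v *)
From HB Require Import structures.
From mathcomp Require Import all_boot all_order all_algebra.
From mathcomp Require Import boolp.

Set Implicit Arguments.
Unset Strict Implicit.
Unset Printing Implicit Defensive.

Import Order.TTheory GRing.Theory Num.Theory.
Local Open Scope ring_scope.

(* [None] stands for an unspecified block. *)
Definition partial_block_mx (F : fieldType) (n k : nat) :=
  'M[option 'M[F]_k]_n.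

Definition completion (F : fieldType) (n k : nat)
    (P : partial_block_mx F n k) (B : 'M[F]_(\sum_(i < n) k)) : Prop :=
  forall i j : 'I_n,
    if P i j is Some X then submxblock B i j = X else True.

Lemma completion_rank_exists (F : fieldType) (n k : nat)
    (P : partial_block_mx F n k) :
  exists r : nat, `[< exists2 B, completion P B & \rank B = r >].
Proof.
pose B : 'M[F]_(\sum_(i < n) k) := \mxblock_(i, j) odflt 0 (P i j).
exists (\rank B); apply/asboolP; exists B => // i j.
by rewrite mxblockK; case: (P i j).
Qed.

Definition mr (F : fieldType) (n k : nat) (P : partial_block_mx F n k) : nat :=
  ex_minn (completion_rank_exists P).

Lemma mrP (F : fieldType) (n k : nat) (P : partial_block_mx F n k) :
  (exists2 B, completion P B & \rank B = mr P)
  /\ forall B, completion P B -> (mr P <= \rank B)%N.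
Proof.
rewrite /mr; case: ex_minnP => r /asboolP Pr minr; split=> // B cB.
by apply: minr; apply/asboolP; exists B.
Qed.

(* [ordS] is the cyclic successor on ['I_n], so the blocks (i, ordS i) are the
   (i, i+1) for i < n together with the corner block (n, 1). Only the entries of
   [A] at these places and on the diagonal matter, here and in [cycle_prod]. *)
Definition cycle_pbm (F : fieldType) (n k : nat) (A : 'M['M[F]_k]_n) :
    partial_block_mx F n k :=
  \matrix_(i, j) if (j == i) || (j == ordS i) then Some (A i j) else None.

(* The factors are multiplied from left to right in increasing order of i. *)
Definition cycle_prod (F : fieldType) (n k : nat) (A : 'M['M[F]_k]_n) :
    'M[F]_k :=
  \prod_(i < n) (invmx (A i i) *m A i (ordS i)).

(* The columns of [cokermx M] span the v such that M *m v = 0, whereas [kermx M]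
   is the kernel of M acting on row vectors. *)
Definition dim_ker (F : fieldType) (k : nat) (M : 'M[F]_k) : nat :=
  \rank (cokermx M).

Definition eigenvalues_in_field (F : fieldType) (k : nat) (M : 'M[F]_k) :=
  exists s : k.-tuple F, char_poly M = \prod_(a <- s) ('X - a%:P).

(* Main.v *)
Require Import Defs.
From HB Require Import structures.
From mathcomp Require Import all_boot all_order all_algebra.
From mathcomp Require Import zify.

Set Implicit Arguments.
Unset Strict Implicit.
Unset Printing Implicit Defensive.

Import Order.TTheory GRing.Theory Num.Theory.
Local Open Scope ring_scope.

(** Lower bound.  In a completion [B] of rank r, the block rows span n subspaces of
    dimension k inside the row space of [B], so their intersection has dimension at
    least nk - (n-1)r.  A row vector v of this intersection satisfies
    v_{i+1} = v_i A_ii^-1 A_{i,i+1} for its blocks, cyclically, so v is determined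
    by v_1 and v_1 H = v_1; hence the intersection has dimension at most d.

    Upper bounds.  After block row and column operations all the specified blocks
    are identities except the corner one, which is a conjugate L of H; a completion
    of rank at most r then amounts to a family of products X_i Y_j through
    dimension r.  If L = I, take all factors equal to I.  If k = n - 1 and L is
    upper triangular, let row j of Y_i be y_j for j < i and y_j L for j >= i, so
    that Y_i and Y_{i+1} differ only in row i, and let X_i annihilate the i-th
    basis vector and invert Y_i deprived of its row i.  The choice y_0 = e_0,
    y_j = e_j + e_{j-1}, y_k = e_{k-1} makes all these square matrices
    invertible. *)

(** * Triangularization of matrices with split characteristic polynomial *)

Lemma char_poly_tr (R : comNzRingType) (k : nat) (M : 'M[R]_k) :
  char_poly M^T = char_poly M.
Proof.
by rewrite /char_poly -[RHS]det_tr /char_poly_mx linearB /= tr_scalar_mx map_trmx.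
Qed.

(** The relation lifts to the characteristic matrices over [{poly F}], where the nonzero factor det
    T cancels. *)
Lemma char_poly_similar (F : fieldType) (k : nat) (T M L : 'M[F]_k) :
  T \in unitmx -> T *m M = L *m T -> char_poly M = char_poly L.
Proof.
move=> uT TM; pose Tp := map_mx polyC T.
have nz : \det Tp != 0 by rewrite det_map_mx polyC_eq0 -unitfE -unitmxE.
apply: (mulfI nz); rewrite -det_mulmx [RHS]mulrC -det_mulmx; congr (\det _).
by rewrite mulmxBr mulmxBl scalar_mxC -!map_mxM TM.
Qed.

Lemma char_poly_lblock (R : comNzRingType) (m n : nat) (A : 'M[R]_m)
    (C : 'M[R]_(n, m)) (B : 'M[R]_n) :
  char_poly (block_mx A 0 C B) = char_poly A * char_poly B.
Proof.
rewrite /char_poly /char_poly_mx map_block_mx /= map_mx0.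
by rewrite scalar_mx_block opp_block_mx add_block_mx subr0 det_lblock.
Qed.

Lemma eigenvector_first_row (F : fieldType) (k : nat) (M : 'M[F]_k.+1) (a : F) :
  eigenvalue M a -> exists2 T : 'M[F]_k.+1, T \in unitmx
    & row 0 (T *m M) = a *: row 0 T.
Proof.
case/eigenvalueP => v vM nz_v; exists (row_ebase v); first exact: row_ebase_unit.
(* The rank of [v] is 1, so its elimination form keeps only the first row of [row_ebase v], scaled
   by the 1 by 1 matrix [col_ebase v]. *)
have [c vE] : exists c, v = c *: row 0 (row_ebase v).
  have := mulmx_ebase v; rewrite -mulmxA [col_ebase v]mx11_scalar mul_scalar_mx.
  move=> e; exists (col_ebase v 0 0); rewrite -[LHS]e rank_rV nz_v rowE.
  congr (_ *: (_ *m _)); apply/rowP => j; rewrite !mxE eqxx ltnS leqn0 eq_sym.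
  by rewrite andbT.
have nz_c : c != 0 by apply: contraNneq nz_v => c0; rewrite vE c0 scale0r.
apply: (scalerI nz_c); rewrite row_mul scalemxAl -vE vM {1}vE.
by rewrite !scalerA mulrC.
Qed.

(** Induction on k: taking a left eigenvector as first row of the base change makes the conjugate
    block lower triangular with corner [a], and the remaining members of [s] are the roots for the
    lower right block. *)
Lemma lower_triangularization (F : fieldType) (k : nat) (M : 'M[F]_k)
    (s : seq F) :
  char_poly M = \prod_(a <- s) ('X - a%:P) ->
  exists T L : 'M[F]_k, [/\ T \in unitmx, is_trig_mx L & T *m M = L *m T].
Proof.
elim: k M s => [|k IHk] M s chM.
  exists 1%:M, M; split; rewrite ?unitmx1 ?mul1mx ?mulmx1 //.
  by apply/is_trig_mxP => -[].
case: s chM => [|a s] chM.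
  have := size_char_poly M; rewrite chM big_nil size_poly1 => /eqP.
  by rewrite eqSS.
have /eigenvector_first_row[T uT TM] : eigenvalue M a.
  by rewrite eigenvalue_root_char chM big_cons rootM root_XsubC eqxx.
have [N NT] : exists N : 'M[F]_(1 + k), T *m M = N *m T.
  by exists (T *m M *m invmx T); rewrite mulmxKV.
have rowN : row 0 N = a *: delta_mx 0 0.
  rewrite -[N](mulmxK uT) -NT row_mul TM -scalemxAl -row_mul mulmxV //.
  by rewrite row1.
have NE : N = block_mx a%:M 0 (dlsubmx N) (drsubmx N).
  rewrite -[LHS]submxK; congr (block_mx _ _ _ _).
    apply/matrixP => i j; rewrite !ord1 [RHS]mxE eqxx.
    transitivity (row 0 N 0 0); last by rewrite rowN !mxE mulr1.
    by rewrite !mxE; congr (N _ _); apply: val_inj.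
  apply/matrixP => i j; rewrite ord1 [RHS]mxE.
  transitivity (row 0 N 0 (rshift 1 j)); last by rewrite rowN !mxE mulr0.
  by rewrite !mxE; congr (N _ _); apply: val_inj.
have : char_poly (drsubmx N) = \prod_(b <- s) ('X - b%:P).
  have := chM; rewrite (char_poly_similar uT NT) NE.
  rewrite (char_poly_lblock a%:M (dlsubmx N) (drsubmx N)) big_cons.
  rewrite block_mxKdr [X in X * _](_ : _ = 'X - a%:P); last first.
    by rewrite char_poly_trig ?scalar_mx_is_trig // big_ord1 mxE eqxx.
  by move/(mulfI _); apply; rewrite polyXsubC_eq0.
case/IHk => T1 [L1 [uT1 trL1 TN1]].
pose T2 : 'M[F]_(1 + k) := block_mx 1%:M 0 0 T1.
have uT2 : T2 \in unitmx.
  by rewrite unitmxE det_lblock det1 mul1r -unitmxE.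
pose L2 : 'M[F]_(1 + k) := block_mx a%:M 0 (T1 *m dlsubmx N) L1.
have T2N : T2 *m N = L2 *m T2.
  rewrite {1}NE !mulmx_block !(mul0mx, mulmx0, addr0, add0r, mul1mx, mulmx1).
  by rewrite TN1.
exists (T2 *m T), L2; split.
- by rewrite unitmx_mul uT2.
- by rewrite (@is_trig_block_mx _ 1 k 1 k) // scalar_mx_is_trig trL1 eqxx.
- by rewrite -mulmxA NT !mulmxA T2N.
Qed.

(** Triangularize [M^T] and transpose back; the base change becomes its inverse transpose. *)
Lemma upper_triangularization (F : fieldType) (k : nat) (M : 'M[F]_k)
    (s : seq F) :
  char_poly M = \prod_(a <- s) ('X - a%:P) ->
  exists T L : 'M[F]_k, [/\ T \in unitmx, is_trig_mx L^T & T *m M = L *m T].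
Proof.
rewrite -char_poly_tr => /lower_triangularization[S [K [uS trK SM]]].
exists (invmx S)^T, K^T; rewrite trmxK unitmx_tr unitmx_inv; split=> //.
apply: trmx_inj; rewrite !trmx_mul !trmxK.
by apply: (canLR (mulmxK uS)); rewrite -mulmxA -SM mulKmx.
Qed.

Lemma closed_field_char_poly_split (F : fieldType) (k : nat) (M : 'M[F]_k) :
  GRing.closed_field_axiom F -> eigenvalues_in_field M.
Proof.
move=> closedF.
have split_monic (p : {poly F}) :
    p \is monic -> exists s, p = \prod_(a <- s) ('X - a%:P).
  have [m] := ubnP (size p); elim: m p => // m IHm p le_p mon_p.
  have [/eqP p1|] := boolP (size p == 1%N).
    exists [::]; move: mon_p; rewrite big_nil (size1_polyC (eq_leq p1)).
    by rewrite monicE lead_coefC => /eqP ->.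
  case/(PreClosedField.closed_rootP closedF) => a /factor_theorem[q pE].
  have mon_q : q \is monic by rewrite -(monicMr _ (monicXsubC a)) -pE.
  case: (IHm q) => // [|s qE].
    move: le_p; rewrite pE size_Mmonic ?monicXsubC ?monic_neq0 //.
    by rewrite size_XsubC addn2.
  by exists (a :: s); rewrite big_cons pE qE mulrC.
have [s sE] := split_monic _ (char_poly_monic M).
have sz : size s == k.
  by have := size_char_poly M; rewrite sE size_prod_XsubC => -[->].
by exists (Tuple sz).
Qed.

(** * Lower bound by counting dimensions *)

Lemma rank_bigcap_ge (F : fieldType) (I : Type) (s : seq I) (p N : nat)
    (W : 'M[F]_(p, N)) (R : I -> 'M[F]_N) :
  (forall i, (R i <= W)%MS) ->
  (\rank W + \sum_(i <- s) \rank (R i) <=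
     \rank (W :&: \bigcap_(i <- s) R i)%MS + size s * \rank W)%N.
Proof.
(* Meeting with [W] handles the empty family, whose intersection is the whole space. Each further
   [R i] costs at most rank W - rank (R i), because its sum with a subspace of [W] stays in [W]. *)
move=> leRW; elim: s => [|i s IHs].
  by rewrite !big_nil !addn0 mxrankS // sub_capmx submx_refl submx1.
rewrite !big_cons /= mulSn.
set V := (\bigcap_(j <- s) R j)%MS in IHs *.
have eqV : \rank (W :&: (R i :&: V))%MS = \rank (R i :&: (W :&: V))%MS.
  by rewrite !capmxA (capmxC W).
have := mxrank_sum_cap (R i) (W :&: V)%MS.
have : (\rank (R i + (W :&: V)) <= \rank W)%N.
  by rewrite mxrankS // addsmx_sub leRW capmxSl.
by rewrite -eqV; lia.
Qed.

Section Cycle.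

Variables (F : fieldType) (n k : nat) (A : 'M['M[F]_k]_n.+1).
Hypothesis hdiag : forall i, A i i \in unitmx.
Hypothesis hsucc : forall i, A i (ordS i) \in unitmx.

Let step (i : 'I_n.+1) := invmx (A i i) *m A i (ordS i).
(** Indexing by naturals lets m reach [n.+1], where the product is the whole of H. *)
Let prefix (m : nat) := \prod_(i < m) step (inord i).

Let prefixS m : prefix m.+1 = prefix m *m step (inord m).
Proof. by rewrite /prefix big_ord_recr. Qed.

Let prefix_last : prefix n.+1 = cycle_prod A.
Proof. by apply: eq_bigr => i _; rewrite inord_val. Qed.

Let prefix_unit m : prefix m \in unitmx.
Proof.
elim: m => [|m IHm]; first by rewrite /prefix big_ord0 unitmx1.
by rewrite prefixS !unitmx_mul IHm unitmx_inv hdiag hsucc.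
Qed.

Lemma cycle_prod_unit : cycle_prod A \in unitmx.
Proof. by rewrite -prefix_last prefix_unit. Qed.

Let ordS_max : ordS (ord_max : 'I_n.+1) = ord0.
Proof. by apply: val_inj; rewrite /= modnn. Qed.

Let val_ordS (i : 'I_n.+1) : (i < n)%N -> ordS i = i.+1 :> nat.
Proof. by move=> lt_in; rewrite /= modn_small. Qed.

Lemma rank_bigcap_rows_le (B : 'M[F]_(\sum_(i < n.+1) k))
    (p : nat) (V : 'M[F]_(p, \sum_(i < n.+1) k)) :
  completion (cycle_pbm A) B -> (forall i, V <= submxcol B i)%MS ->
  (\rank V <= dim_ker (cycle_prod A - 1%:M))%N.
Proof.
move=> cB leVB.
have Bii i : submxblock B i i = A i i by have := cB i i; rewrite mxE eqxx.
have BiS i : submxblock B i (ordS i) = A i (ordS i).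
  by have := cB i (ordS i); rewrite mxE eqxx orbT.
(* [submxcol B i] is the i-th block row, so V = D *m submxcol B i for some D; comparing blocks i and
   i + 1 eliminates D. *)
have V_S i : submxrow V (ordS i) = submxrow V i *m step i.
  have /submxP[D ->] := leVB i.
  rewrite -!mul_submxrow -!submxblockEv Bii BiS /step !mulmxA.
  by rewrite mulmxK.
have V_prefix m : (m <= n)%N -> submxrow V (inord m) = submxrow V ord0 *m prefix m.
  elim: m => [|m IHm] lt_mn.
    rewrite /prefix big_ord0 mulmx1; congr (submxrow V _).
    by apply: val_inj; rewrite /= inordK.
  rewrite prefixS mulmxA -IHm 1?ltnW // -V_S; congr (submxrow V _).
  by apply: val_inj; rewrite /= !inordK ?modn_small // ltnW.
have V_fix : submxrow V ord0 *m cycle_prod A = submxrow V ord0.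
  rewrite -prefix_last prefixS mulmxA -V_prefix // -V_S; congr (submxrow V _).
  by rewrite -ordS_max; congr ordS; apply: val_inj; rewrite /= inordK.
have le_V : (\rank V <= \rank (submxrow V ord0))%N.
  have /submxP[D VE] := leVB ord0.
  suff {1}-> : V = submxrow V ord0 *m (invmx (A ord0 ord0) *m submxcol B ord0).
    exact: mxrankM_maxl.
  by rewrite {2}VE -mul_submxrow -submxblockEv Bii !mulmxA mulmxK.
(* Row and column kernels of a square matrix have equal dimension, so d also counts the row vectors
   fixed by H. *)
apply: leq_trans le_V _; rewrite /dim_ker mxrank_coker -mxrank_ker.
by apply: mxrankS; apply/sub_kermxP; rewrite mulmxBr mulmx1 V_fix subrr.
Qed.

Lemma mr_cycle_ge :
  (n.+1 * k <= dim_ker (cycle_prod A - 1%:M) + n * mr (cycle_pbm A))%N.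
Proof.
have [[B cB <-] _] := mrP (cycle_pbm A).
have rk i : \rank (submxcol B i) = k.
  apply/eqP; rewrite eqn_leq rank_leq_row /=.
  rewrite -[X in (X <= _)%N](mxrank_unit (hdiag i)).
  have -> : A i i = submxblock B i i by have := cB i i; rewrite mxE eqxx.
  rewrite submxblockEv -{1}[submxcol B i]mulmx1 -mul_submxrow.
  exact: mxrankM_maxl.
(* [<<_>>] gives a square matrix with the same row space, the form that [rank_bigcap_ge] takes. *)
have leB i : (<<submxcol B i>> <= B)%MS by rewrite genmxE rowsub_sub.
have sum_rk : (\sum_(i <- enum 'I_n.+1) \rank <<submxcol B i>> = n.+1 * k)%N.
  rewrite big_enum (eq_bigr (fun=> k)) => [|i _]; last by rewrite genmxE rk.
  by rewrite sum_nat_const card_ord.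
have := rank_bigcap_ge (enum 'I_n.+1) leB; rewrite sum_rk size_enum_ord.
have : (\rank (B :&: \bigcap_(i <- enum 'I_n.+1) <<submxcol B i>>)%MS
          <= dim_ker (cycle_prod A - 1%:M))%N.
  apply: rank_bigcap_rows_le cB _ => i.
  by rewrite big_enum /= (submx_trans (capmxSr _ _)) // (bigcapmx_inf i) ?genmxE.
lia.
Qed.

(** * Upper bounds from factorizations *)

Lemma mr_le_factorization (r : nat) (X : 'I_n.+1 -> 'M[F]_(k, r))
    (Y : 'I_n.+1 -> 'M[F]_(r, k)) :
  (forall i, X i *m Y i = A i i) ->
  (forall i, X i *m Y (ordS i) = A i (ordS i)) ->
  (mr (cycle_pbm A) <= r)%N.
Proof.
move=> XY XYS; have [_ min_mr] := mrP (cycle_pbm A).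
apply: (leq_trans (min_mr (\mxcol_i X i *m \mxrow_j Y j) _)).
  rewrite mul_mxcol_mxrow => i j; rewrite mxE.
  by case: ifP => // /orP[] /eqP ->; rewrite mxblockK.
exact: leq_trans (mxrankM_maxl _ _) (rank_leq_col _).
Qed.

(** Undo the normalization with P_i = T *m prefix i: the factors A_ii P_i^-1 X_i and Y_i P_i
    multiply to A_ii on the diagonal, and to A_ii P_i^-1 P_{i+1} = A_{i,i+1} next to it. *)
Lemma mr_le_normalized (r : nat) (T L : 'M[F]_k)
    (X : 'I_n.+1 -> 'M[F]_(k, r)) (Y : 'I_n.+1 -> 'M[F]_(r, k)) :
  T \in unitmx -> T *m cycle_prod A = L *m T ->
  (forall i, X i *m Y i = 1%:M) ->
  (forall i : 'I_n.+1, (i < n)%N -> X i *m Y (ordS i) = 1%:M) ->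
  X ord_max *m Y ord0 = L ->
  (mr (cycle_pbm A) <= r)%N.
Proof.
move=> uT TH XY XYS XYlast.
pose P m := T *m prefix m.
have uP m : P m \in unitmx by rewrite unitmx_mul uT prefix_unit.
have PS (i : 'I_n.+1) : P i.+1 = P i *m step i.
  by rewrite /P prefixS inord_val mulmxA.
have P0 : P 0%N = T by rewrite /P /prefix big_ord0 mulmx1.
have step_eq i : A i i *m step i = A i (ordS i) by rewrite mulKVmx.
apply: (@mr_le_factorization r (fun i => A i i *m invmx (P i) *m X i)
                               (fun i => Y i *m P i)) => i.
  by rewrite mulmxA -(mulmxA _ (X i)) XY mulmx1 mulmxKV.
rewrite mulmxA -(mulmxA _ (X i)).
have [lt_in|ge_in] := ltnP i n.
  by rewrite XYS // mulmx1 val_ordS // PS mulmxA mulmxKV.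
have -> : i = ord_max by apply/val_inj/anti_leq; rewrite ge_in -ltnS ltn_ord.
(* At the corner, L P_0 = L T = T H = P_{n+1}, so the same computation applies. *)
rewrite ordS_max XYlast -!mulmxA P0 -TH -prefix_last -/(P n.+1).
by rewrite (PS ord_max) mulKmx // step_eq ordS_max.
Qed.

End Cycle.

(** * Normalized factors for k + 1 blocks of size k *)

Section NormalizedFamily.

Variables (F : fieldType) (k : nat) (L : 'M[F]_k).
Hypotheses (uL : L \in unitmx) (trL : is_trig_mx L^T).

(** Comparing indices as naturals drops the out-of-range terms, which covers the end rows e_0 and
    e_{k-1} without separate cases. *)
Let Y : 'M[F]_(k.+1, k) :=
  \matrix_(j, c) ((c == j :> nat)%:R + (c.+1 == j :> nat)%:R).

(* The matrix Y_i of the introduction; the rows of [Y] are the y_j. *)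
Let Z (i : 'I_k.+1) : 'M[F]_(k.+1, k) :=
  \matrix_(j, c) if (j < i)%N then Y j c else (Y *m L) j c.

Let Y_eq0 (j : 'I_k.+1) (c : 'I_k) :
  ((j < c) || (c.+1 < j))%N -> Y j c = 0.
Proof.
move=> jc; have [/negPf c0 /negPf c1] : c != j :> nat /\ c.+1 != j by lia.
by rewrite mxE c0 c1 addr0.
Qed.

Let L_eq0 (r c : 'I_k) : (c < r)%N -> L r c = 0.
Proof. by move=> lt_cr; have /is_trig_mxP/(_ c r lt_cr) := trL; rewrite mxE. Qed.

Let L_diag r : L r r != 0.
Proof.
have := uL; rewrite unitmxE unitfE -det_tr det_trig //.
by move/prodf_neq0/(_ r isT); rewrite mxE.
Qed.

(* The first [i] rows of [row' i (Z i)] are lower triangular with unit diagonal,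
   the other rows are upper triangular with the diagonal entries of [L], hence
   the matrix is a product of a lower and an upper triangular matrix. *)
Let row'_Z_unit i : row' i (Z i) \in unitmx.
Proof.
have lift_lo (r : 'I_k) : (r < i)%N -> lift i r = r :> nat.
  by move=> lt_ri; rewrite /= /bump leqNgt lt_ri.
have lift_hi (r : 'I_k) : (i <= r)%N -> lift i r = r.+1 :> nat.
  by move=> le_ir; rewrite /= /bump le_ir.
pose D1 : 'M[F]_k :=
  \matrix_(r, b) if (r < i)%N then Y (lift i r) b else (r == b)%:R.
pose D2 : 'M[F]_k :=
  \matrix_(r, c) if (r < i)%N then (r == c)%:R else (Y *m L) (lift i r) c.
have D1_lo (r b : 'I_k) : (r < i)%N -> D1 r b = Y (lift i r) b.
  by move=> lt_ri; rewrite mxE lt_ri.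
have D1_hi (r b : 'I_k) : (i <= r)%N -> D1 r b = (r == b)%:R.
  by move=> le_ir; rewrite mxE ltnNge le_ir.
have D2_lo (r c : 'I_k) : (r < i)%N -> D2 r c = (r == c)%:R.
  by move=> lt_ri; rewrite mxE lt_ri.
have D2_hi (r c : 'I_k) : (i <= r)%N -> D2 r c = (Y *m L) (lift i r) c.
  by move=> le_ir; rewrite mxE ltnNge le_ir.
have -> : row' i (Z i) = D1 *m D2.
  apply/matrixP => r c; rewrite [LHS]mxE [RHS]mxE.
  have [lt_ri|le_ir] := ltnP r i.
    rewrite [LHS]mxE lift_lo // lt_ri -D1_lo //.
    transitivity (\sum_b D1 r b * (b == c)%:R).
      rewrite (bigD1 c) //= eqxx mulr1 big1 ?addr0 // => b /negPf ->.
      by rewrite mulr0.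
    (* Row r < i of [D1] is supported on columns b < i, where [D2] agrees with the identity. *)
    apply: eq_bigr => b _; have [lt_bi|le_ib] := ltnP b i; first by rewrite D2_lo.
    by rewrite D1_lo // Y_eq0 ?mul0r // lift_lo // (leq_trans lt_ri).
  rewrite [LHS]mxE lift_hi // ltnNge leqW //= -D2_hi //.
  rewrite (bigD1 r) //= D1_hi // eqxx mul1r big1 ?addr0 // => b neq_br.
  by rewrite D1_hi // eq_sym (negPf neq_br) mul0r.
rewrite unitmx_mul !unitmxE -[\det D2]det_tr !det_trig; last 2 first.
- apply/is_trig_mxP => r b lt_rb.
  have [lt_ri|le_ir] := ltnP r i; first by rewrite D1_lo // Y_eq0 // lift_lo ?lt_rb.
  by rewrite D1_hi // -val_eqE ltn_eqF.
- apply/is_trig_mxP => c r lt_cr; rewrite mxE.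
  have [lt_ri|le_ir] := ltnP r i; first by rewrite D2_lo // -val_eqE gtn_eqF.
  rewrite D2_hi // mxE big1 // => b _; have [le_rb|lt_br] := leqP r b.
    by rewrite L_eq0 ?mulr0 // (leq_trans lt_cr).
  by rewrite Y_eq0 ?mul0r // lift_hi // ltnS lt_br orbT.
rewrite !unitfE; apply/andP; split; apply/prodf_neq0 => r _.
  have [lt_ri|le_ir] := ltnP r i; last by rewrite D1_hi // eqxx oner_eq0.
  by rewrite D1_lo // mxE lift_lo // eqxx gtn_eqF // addr0 oner_eq0.
rewrite mxE; have [lt_ri|le_ir] := ltnP r i.
  by rewrite D2_lo // eqxx oner_eq0.
(* Row r + 1 of [Y] is supported on columns r and r + 1, and [L] vanishes below the diagonal, so
   only [L r r] survives. *)
rewrite D2_hi // mxE (bigD1 r) //= big1 ?addr0 => [|b neq_br].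
  by rewrite mxE lift_hi // eqxx ltn_eqF // add0r mul1r.
have [lt_rb|lt_br|/val_inj eq_rb] := ltngtP r b.
- by rewrite L_eq0 ?mulr0.
- by rewrite Y_eq0 ?mul0r // lift_hi // ltnS lt_br orbT.
- by rewrite eq_rb eqxx in neq_br.
Qed.

Let X (i : 'I_k.+1) : 'M[F]_(k, k.+1) :=
  invmx (row' i (Z i)) *m row' i 1%:M.

Let X_mul i (M : 'M[F]_(k.+1, k)) : X i *m M = invmx (row' i (Z i)) *m row' i M.
Proof. by rewrite /X -mulmxA row'Esub mul_rowsub_mx mul1mx -row'Esub. Qed.

Lemma normalized_family_exists :
  exists (X : 'I_k.+1 -> 'M[F]_(k, k.+1)) (Y : 'I_k.+1 -> 'M[F]_(k.+1, k)),
    [/\ forall i, X i *m Y i = 1%:M,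
        forall i : 'I_k.+1, (i < k)%N -> X i *m Y (ordS i) = 1%:M
      & X ord_max *m Y ord0 = L].
Proof.
exists X, Z; split=> [i|i lt_ik|].
- by rewrite X_mul mulVmx.
- rewrite X_mul (_ : row' i (Z (ordS i)) = row' i (Z i)) ?mulVmx //.
  apply/matrixP => r c; rewrite 2!mxE [in RHS]mxE [in RHS]mxE /= modn_small //.
  by rewrite ltnS leq_eqVlt eq_sym (negPf (neq_bump i r)).
(* Deleting the last row of [Z ord_max] leaves rows of [Y] only, while [Z ord0] is [Y *m L]
   throughout. *)
- rewrite X_mul (_ : row' _ (Z ord0) = row' ord_max (Z ord_max) *m L) ?mulKmx //.
  have -> : Z ord0 = Y *m L by apply/matrixP => j c; rewrite mxE.
  rewrite row'Esub -mul_rowsub_mx -row'Esub; congr (_ *m _).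
  by apply/matrixP => r c; rewrite !mxE lift_max ltn_ord.
Qed.

End NormalizedFamily.

Theorem theorem3p2 (F : fieldType) (n k : nat) (hn : (3 <= n)%N)
    (hk : (1 <= k)%N) (A : 'M['M[F]_k]_n)
    (hdiag : forall i : 'I_n, A i i \in unitmx)
    (hsucc : forall i : 'I_n, A i (ordS i) \in unitmx) :
  let H := cycle_prod A in
  let d := dim_ker (H - 1%:M) in
  let bound : rat := ((n * k)%:R - d%:R) / (n%:R - 1) in
  [/\ bound <= (mr (cycle_pbm A))%:R,
      d = k -> (mr (cycle_pbm A))%:R = bound /\ mr (cycle_pbm A) = k,
      k = n.-1 -> d = 0%N -> eigenvalues_in_field H ->
        (mr (cycle_pbm A))%:R = bound /\ mr (cycle_pbm A) = n
    & GRing.closed_field_axiom F -> eigenvalues_in_field H].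
Proof.
case: n hn A hdiag hsucc => // n hn A hdiag hsucc H d bound.
have n_gt0 : (0 < n)%N by lia.
have ge_mr : (n.+1 * k <= d + n * mr (cycle_pbm A))%N by exact: mr_cycle_ge.
have nQ : n.+1%:R - 1 = n%:R :> rat by rewrite -addn1 natrD addrK.
have bound_eq (m : nat) : (n.+1 * k = d + n * m)%N -> m%:R = bound.
  move=> e; rewrite /bound nQ e natrD natrM addrC addKr mulrC mulKf //.
  by rewrite pnatr_eq0 -lt0n.
split.
- rewrite /bound nQ ler_pdivrMr ?ltr0n // lerBlDl -natrM -natrD ler_nat.
  by rewrite [(_ * n)%N]mulnC.
- move=> dk.
  have H1 : H = 1%:M.
    apply/subr0_eq/eqP; rewrite -mxrank_eq0 -(subKn (rank_leq_col _)).
    by rewrite -mxrank_coker -[\rank (cokermx _)]/d dk subnn.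
  have le_mr : (mr (cycle_pbm A) <= k)%N.
    apply: (@mr_le_normalized _ _ _ _ hdiag hsucc k 1%:M H
              (fun=> 1%:M) (fun=> 1%:M)); rewrite ?unitmx1 ?mul1mx ?mulmx1 //.
  have mrE : mr (cycle_pbm A) = k.
    (* With d = k, [ge_mr] leaves n k <= n mr, and n > 0 cancels. *)
    by apply/eqP; rewrite eqn_leq le_mr -(leq_pmul2l n_gt0); lia.
  by split=> //; apply: bound_eq; rewrite mrE dk mulSn.
- move=> kn d0 [s Hs].
  have [T [L [uT trL TH]]] := upper_triangularization Hs.
  have uH : H \in unitmx by exact: cycle_prod_unit.
  have uL : L \in unitmx.
    by rewrite -(mulmxK uT L) -TH !unitmx_mul uT uH unitmx_inv.
  have [X [Y [XY XYS XYlast]]] := normalized_family_exists uL trL.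
  (* The number of blocks is now [n.+1], so k = n and the family has one index per block. *)
  rewrite /= in kn; subst k.
  have le_mr : (mr (cycle_pbm A) <= n.+1)%N.
    exact: (mr_le_normalized hdiag hsucc uT TH XY XYS XYlast).
  have mrE : mr (cycle_pbm A) = n.+1.
    by apply/eqP; rewrite eqn_leq le_mr -(leq_pmul2l n_gt0); lia.
  by split=> //; apply: bound_eq; rewrite mrE d0 mulnC.
- exact: closed_field_char_poly_split.
Qed.
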